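(* Let $t\ge 3$ and let $g(z_1)=\sum_{j=1}^t e^{a_jz_1+\beta_j}$ be a univariate exponential $t$-sum, with pairwise distinct $a_1,\ldots,a_t\in\mathbb{R}$ and $\beta_1,\ldots,\beta_t\in\mathbb{C}$. Let $\delta(g):=\min_{p\neq q}|a_p-a_q|$, $s:=\#\mathrm{Trop}(g)$, $u_{\min}:=\min\mathrm{Trop}(g)$, $u_{\max}:=\max\mathrm{Trop}(g)$, and let $$U_g:=\left(u_{\min}-\frac{\log 2}{\delta(g)},\,u_{\max}+\frac{\log 2}{\delta(g)}\right)\cap\bigcup_{u\in\mathrm{Trop}(g)}\left(u-\frac{\log 3}{\delta(g)},\,u+\frac{\log 3}{\delta(g)}\right).$$ Then $1\le s\le t-1$ and: (1) $\mathrm{Re}(Z(g))\subset U_g$. (2) $\mathrm{Re}(Z(g))$ has at least one point in each connected component of $U_g$. (3) For any $u\in\mathrm{Trop}(g)$ there is a root $\zeta\in\mathbb{C}$ of $g$ with $$|u-\mathrm{Re}(\zeta)|<\frac{(\log 9)s-\log\frac{9}{2}}{\delta(g)}\le\frac{(\log 9)t-\log\frac{81}{2}}{\delta(g)}<\frac{2.2t-3.7}{\delta(g)}.$$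
   Context: $Z(g)\subset\mathbb{C}$ is the set of complex zeros of $g$, and $\mathrm{Re}(Z(g)):=\{\mathrm{Re}(z):z\in Z(g)\}\subset\mathbb{R}$. The tropical variety is $\mathrm{Trop}(g):=\{\mathrm{Re}(z): z\in\mathbb{C},\ \max_j|e^{a_jz+\beta_j}|\text{ is attained at at least two distinct indices } j\}\subset\mathbb{R}$. $\#S$ denotes the cardinality of $S$, and $\log$ is the natural logarithm. *)

(* Defs.v *)
From HB Require Import structures.
From mathcomp Require Export all_boot all_order all_algebra.
From mathcomp Require Export all_classical all_reals all_analysis.
From mathcomp Require Export complex.

Set Implicit Arguments.
Unset Strict Implicit.
Unset Printing Implicit Defensive.

Export Order.TTheory GRing.Theory Num.Theory.
Export numFieldNormedType.Exports.

Local Open Scope classical_set_scope.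
Local Open Scope complex_scope.
Local Open Scope ring_scope.

Definition cexp (R : realType) (z : R[i]) : R[i] :=
  (expR (complex.Re z))%:C * (cos (complex.Im z) +i* sin (complex.Im z)).

Section ExponentialSums.
Variables (R : realType) (t : nat) (a : 'I_t -> R) (beta : 'I_t -> R[i]).

Definition exp_term (j : 'I_t) (z : R[i]) : R[i] :=
  cexp ((a j)%:C * z + beta j).

Definition exp_sum (z : R[i]) : R[i] := \sum_(j < t) exp_term j z.

Definition zeros : set R[i] := [set z | exp_sum z = 0].

(* The norm of R[i] takes its values in the real elements of R[i], on which
   the (partial) order of R[i] is the order of R. *)
Definition max_term_at (z : R[i]) (p : 'I_t) : Prop :=
  forall j : 'I_t, `|exp_term j z| <= `|exp_term p z|.

Definition trop : set R :=
  @complex.Re R @` [set z | exists p q : 'I_t,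
                      [/\ p != q, max_term_at z p & max_term_at z q]].

(* The sets below are finite, and nonempty for [1 < t] and pairwise distinct
   exponents, so their inf and sup are a minimum and a maximum. *)
Definition min_gap : R :=
  inf [set x | exists p q : 'I_t, p != q /\ x = `|a p - a q|].

Definition trop_min : R := inf trop.
Definition trop_max : R := sup trop.

Definition root_region : set R :=
  `]trop_min - ln 2 / min_gap, trop_max + ln 2 / min_gap[%classic `&`
  \bigcup_(u in trop) `]u - ln 3 / min_gap, u + ln 3 / min_gap[%classic.

End ExponentialSums.

(* Main.v *)
Require Import Defs.
From mathcomp Require Import ring lra.

(** Write the modulus of the [j]-th term on the line of real part [x] as the
    exponential of [a j * x + Re (beta j)].  The tropical variety is the set of
    kinks of the maximum of these lines.

    If [x] lies outside the root region, one term is strictly larger than the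
    sum of the moduli of all the others.  Indeed the line that is maximal at [x]
    remains maximal up to the nearest kink on each side.  Hence, with the gap
    between exponents as unit, the other terms decay geometrically as the
    exponents move away from the dominant one: with ratio [1/3] on each side
    when all kinks are far ([dominates_far_from_kinks]), and with ratio [1/2] on
    a single side when [x] is beyond the last kink
    ([dominates_right_of_kinks]).  A sum with a dominant term does not vanish,
    which confines the real parts of the zeros.

    Consider a component [(c, d)] of the region.  The ends are outside the
    region, so a term [p] dominates at [c] and a term [q] at [d], and [p <> q]
    because the component contains a kink.  Going up by [T] along the line of
    real part [c], the argument of the sum follows that of its dominant term and
    increases by [a p * T], up to [pi]; on the other side it increases by
    [a q * T], up to [pi].  If there were no zero in between, the increase of
    the argument would be a continuous function of the abscissa.  By Dirichlet's
    approximation ([common_near_period]) there are arbitrarily large [T] that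
    are almost periods of all terms; then the increase of the argument is almost
    a multiple of [2 pi] for every abscissa, and so it varies by less than [pi]
    over [(c, d)].  This contradicts [a p <> a q] for large [T]
    ([strip_winding], [root_between_dominants]).  Continuous arguments are
    produced by sampling each curve at finitely many points and adding the
    arctangents of the successive turns.

    Finally, the component of a kink [u] is covered by the intervals of radius
    [ln 3 / min_gap] around the [s] kinks and ends at most [ln 2 / min_gap]
    beyond the last one, so that it extends on each side of [u] by at most
    [(2 (s - 1) ln 3 + ln 2) / min_gap] ([ball_chain_lt_sup]). *)

Set Implicit Arguments.
Unset Strict Implicit.
Unset Printing Implicit Defensive.

Local Open Scope classical_set_scope.
Local Open Scope ring_scope.

(** * Kinks of a maximum of lines *)

Section Kinks.
Variables (R : realType) (t : nat).
Implicit Types (a b : 'I_t -> R) (p q j : 'I_t) (u x y : R).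

Definition top_line a b x p : Prop :=
  forall j, a j * x + b j <= a p * x + b p.

Definition kinks a b : set R :=
  [set u | exists p q, [/\ p != q, top_line a b u p & top_line a b u q]].

Definition dominates a b x p : Prop :=
  \sum_(j < t | j != p) expR (a j * x + b j) < expR (a p * x + b p).

Lemma top_line_ex a b x (p0 : 'I_t) : exists p, top_line a b x p.
Proof.
case: (@Order.TotalTheory.arg_maxP _ R 'I_t p0 xpredT
  (fun j => a j * x + b j) isT) => p _ Hp.
by exists p => j; apply: Hp.
Qed.

Lemma top_line_opp a b x p : top_line (\- a) b (- x) p <-> top_line a b x p.
Proof. by split=> H j; have := H j; rewrite /= !mulrNN. Qed.

Lemma kinks_opp a b x : kinks (\- a) b (- x) <-> kinks a b x.
Proof.
by split=> -[p [q [pq /top_line_opp Hp /top_line_opp Hq]]]; exists p, q; split.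
Qed.

(** The witness is the largest abscissa at which a line of smaller slope crosses
    the line [p].  No line exceeds [p] there, so this crossing is a kink; moving
    right from it to [y] gives each line of smaller slope a deficit at least
    proportional to the slope difference. *)
Lemma nearest_kink_left a b y p q : injective a ->
  top_line a b y p -> a q < a p ->
  exists u, [/\ kinks a b u, u <= y &
    forall j, a j < a p -> (a p - a j) * (y - u) <= (a p * y + b p) - (a j * y + b j)].
Proof.
move=> ainj topp qp.
(* Abscissa of the crossing of the lines j and p. *)
pose cr j := (b j - b p) / (a p - a j).
case: (@Order.TotalTheory.arg_maxP _ R 'I_t q (fun j => a j < a p) cr qp)
  => k kp Hk.
have gap j : a j < a p -> 0 < a p - a j by rewrite subr_gt0.
have crE j : a j < a p -> (a p - a j) * cr j = b j - b p.
  by move=> /gap jp; rewrite /cr mulrC divfK ?gt_eqF.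
have cry : cr k <= y.
  rewrite /cr ler_pdivrMr ?gap //; have := topp k; lra.
have crle j : a j < a p -> b j - b p <= (a p - a j) * cr k.
  by move=> jp; rewrite -crE //; apply: ler_wpM2l; [exact/ltW/gap|exact: Hk].
have toppk : top_line a b (cr k) p.
  move=> j; have [jp|pj|pj] := ltgtP (a j) (a p).
  - have := crle j jp; lra.
  - have := topp j.
    have : 0 <= (a j - a p) * (y - cr k) by apply: mulr_ge0; rewrite subr_ge0// ltW.
    nra.
  - by rewrite (ainj _ _ pj).
exists (cr k); split=> //.
  exists p, k; split=> //; first by apply: contraTneq kp => <-; rewrite ltxx.
  by move=> j; apply: le_trans (toppk j) _; have := crE k kp; lra.
move=> j jp; have := crle j jp; lra.
Qed.

Lemma nearest_kink_right a b y p q : injective a ->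
  top_line a b y p -> a p < a q ->
  exists u, [/\ kinks a b u, y <= u &
    forall j, a p < a j -> (a j - a p) * (u - y) <= (a p * y + b p) - (a j * y + b j)].
Proof.
move=> ainj topp qp.
have ainjN : injective (\- a) by move=> i j /= /oppr_inj/ainj.
have qpN : (\- a) q < (\- a) p by rewrite /= ltrN2.
have [u [ku uy Hu]] := nearest_kink_left ainjN ((top_line_opp a b y p).2 topp) qpN.
exists (- u); split; last 2 first.
- by rewrite lerNr.
- by move=> j pj; have := Hu j; rewrite /= ltrN2 => /(_ pj); lra.
by apply/kinks_opp; rewrite opprK.
Qed.

Lemma kinks_neq0 a b : (1 < t)%N -> injective a -> kinks a b !=set0.
Proof.
move=> t1 ainj.
pose i0 : 'I_t := Ordinal (ltnW t1); pose i1 : 'I_t := Ordinal t1.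
have [p topp] := top_line_ex a b 0 i0.
have [q qp] : exists q, q != p.
  by have [->|p0] := eqVneq p i0; [exists i1|exists i0; rewrite eq_sym].
have : a q != a p by apply: contra qp => /eqP/ainj ->.
rewrite neq_lt => /orP[] h.
  by have [u [ku _ _]] := nearest_kink_left ainj topp h; exists u.
by have [u [ku _ _]] := nearest_kink_right ainj topp h; exists u.
Qed.

(** Sending a kink to the steepest line that is maximal there is injective: a
    line that is steepest at two kinks would lie below a less steep one at the
    left kink.  The line of least slope is never reached, whence the [- 1]. *)
Lemma kinks_card_le a b : injective a -> (kinks a b #<= `I_(t - 1))%card.
Proof.
move=> ainj; case: (posnP t) => [t0|tpos].
  have -> : kinks a b = set0.
    by apply/seteqP; split=> // u [[p pt] _]; exfalso; move: pt; rewrite t0.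
  by rewrite card_ge0.
pose i0 : 'I_t := Ordinal tpos.
case: (@Order.TotalTheory.arg_minP _ R 'I_t i0 xpredT a isT) => m _ Hm.
pose steep u p := [/\ top_line a b u p & forall j, top_line a b u j -> a j <= a p].
have steepE u : {p | kinks a b u -> steep u p}.
  apply: cid.
  have [p topp] := top_line_ex a b u i0.
  case: (@Order.TotalTheory.arg_maxP _ R 'I_t p (fun j => `[< top_line a b u j >]) a).
    exact/asboolP.
  move=> k /asboolP topk Hk; exists k => _; split=> // j topj.
  by apply: Hk; apply/asboolP.
pose st u := projT1 (steepE u).
have stP u : kinks a b u -> steep u (st u) by rewrite /st; case: (steepE u).
have low u : kinks a b u -> exists q, top_line a b u q /\ a q < a (st u).
  move=> ku; have [topS maxS] := stP u ku.
  case: (ku) => p [q [pq topp topq]].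
  have [pS|pS] := eqVneq p (st u).
    exists q; split=> //; rewrite lt_neqAle maxS // andbT.
    by apply: contra pq => /eqP/ainj ->; rewrite pS.
  exists p; split=> //; rewrite lt_neqAle maxS // andbT.
  by apply: contra pS => /eqP/ainj ->.
have stinj : {in kinks a b &, injective st}.
  have lem u v : kinks a b u -> kinks a b v -> st u = st v -> ~ u < v.
    move=> ku kv E uv; have [q [topq qlt]] := low v kv.
    have [tu _] := stP u ku; have [tv _] := stP v kv.
    have := tu q; have := topq (st v); rewrite E.
    have : 0 < (a (st v) - a q) * (v - u) by rewrite mulr_gt0 // subr_gt0.
    nra.
  move=> u v /set_mem ku /set_mem kv E; apply/eqP.
  case: ltgtP => // h; exfalso; [exact: (lem u v)|exact: (lem v u)].
have stm u : kinks a b u -> st u \in [set j : 'I_t | j != m]%SET.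
  move=> ku; rewrite inE; have [q [_ qlt]] := low u ku.
  by apply: contraTneq qlt => ->; rewrite -leNgt Hm.
have [/nonemptyPn ->|/contrapT[u0 ku0]] := pselect (~ (kinks a b !=set0)).
  by rewrite card_ge0.
pose rk u : nat := enum_rank_in (stm u0 ku0) (st u).
have rkinj : {in kinks a b &, injective rk}.
  move=> u v ku kv /val_inj E; apply: stinj => //.
  by move: E; apply: enum_rank_in_inj; [exact: (stm u (set_mem ku))|exact: (stm v (set_mem kv))].
rewrite -(card_le_eql (inj_card_eq rkinj)); apply: subset_card_le.
move=> _ [u ku <-] /=; rewrite /rk; apply: leq_trans (ltn_ord _) _.
by rewrite cardsE cardC1 card_ord subn1.
Qed.
End Kinks.

(** * Dominant terms away from the kinks *)

Lemma sum_geometric_lt (R : realType) (m : R) N : 1 < m ->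
  \sum_(k < N | (0 < k)%N) m ^- k < (m - 1)^-1.
Proof.
move=> m1; have m0 : 0 < m by apply: lt_trans m1.
have d0 : 0 < m - 1 by rewrite subr_gt0.
case: N => [|N]; first by rewrite big_ord0 invr_gt0.
rewrite big_mkcond big_ord_recl /= add0r.
under eq_bigr => i _ do rewrite /bump leq0n add1n /=.
suff -> : \sum_(i < N) m ^- i.+1 = (m - 1)^-1 * (1 - m ^- N).
  rewrite -[ltRHS]mulr1 ltr_pM2l ?invr_gt0 // ltrBlDr ltrDl invr_gt0.
  exact: exprn_gt0.
elim: N => [|N IH]; first by rewrite big_ord0 expr0 invr1 subrr mulr0.
rewrite big_ord_recr /= IH exprS; field.
by rewrite !gt_eqF // exprn_gt0.
Qed.

(** Points at mutual distance at least [1] have distinct integer parts, so the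
    sum is at most the geometric series of ratio [m^-1] without its first
    term. *)
Lemma separated_sum_lt (R : realType) (n : nat) (D : {pred 'I_n}) (x : 'I_n -> R) (m : R) :
  1 < m -> (forall j, j \in D -> 1 <= x j) ->
  {in D &, forall i j, i != j -> 1 <= `|x i - x j|} ->
  \sum_(j in D) expR (- (ln m * x j)) < (m - 1)^-1.
Proof.
move=> m1 x1 sep; have m0 : 0 < m by apply: lt_trans m1.
have lm0 : 0 < ln m by apply: ln_gt0.
pose N := (\max_(j < n) Num.truncn (x j)).+1.
have kN j : (Num.truncn (x j) < N)%N by rewrite ltnS; apply: (leq_bigmax j).
pose k j : 'I_N := Ordinal (kN j).
have kx j : j \in D -> (k j)%:R <= x j < (k j)%:R + 1.
  move=> jD; have := truncn_itv (le_trans ler01 (x1 j jD)).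
  by rewrite -[_.+1]addn1 natrD.
have kinj : {in D &, injective k}.
  move=> i j iD jD E; apply: contrapT => /eqP ij.
  have := sep i j iD jD ij; have := kx i iD; have := kx j jD; rewrite E.
  move=> /andP[? ?] /andP[? ?] sp.
  by have : `|x i - x j| < 1; [rewrite ltr_norml; lra|rewrite ltNge sp].
apply: le_lt_trans (sum_geometric_lt N m1).
apply: (@le_trans _ _ (\sum_(j in D) m ^- k j)).
  apply: ler_sum => j jD; rewrite expRN lef_pV2 ?posrE ?expR_gt0 ?exprn_gt0 //.
  rewrite -[X in X ^+ _]lnK ?posrE // -expRM_natl ler_expR mulrC ler_pM2l //.
  by case/andP: (kx j jD).
rewrite -(big_imset (fun i : 'I_N => m ^- i) kinj) /=.
rewrite big_mkcond [leRHS]big_mkcond; apply: ler_sum => i _.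
case: ifPn => [/imsetP[j jD ->]|_].
  have /andP[_] := kx j jD; have := x1 j jD.
  case: posnP => // -> ? ?; exfalso; lra.
by case: ifP => // _; rewrite invr_ge0 exprn_ge0 // ltW.
Qed.

Section Dominance.
Variables (R : realType) (t : nat).
Implicit Types (a b : 'I_t -> R) (p q j : 'I_t) (u x y d : R).

Definition separated a d : Prop := forall i j, i != j -> d <= `|a i - a j|.

Lemma separated_inj a d : 0 < d -> separated a d -> injective a.
Proof.
move=> d0 sep i j E; apply/eqP; apply: contraT => ij.
by have := sep i j ij; rewrite E subrr normr0 leNgt d0.
Qed.

Lemma separated_opp a d : separated a d -> separated (\- a) d.
Proof. by move=> sep i j ij; rewrite /= -opprD normrN; exact: sep. Qed.

Lemma dominates_opp a b x p : dominates (\- a) b (- x) p <-> dominates a b x p.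
Proof.
by rewrite /dominates /= mulrNN; under eq_bigr => j _ do rewrite mulrNN.
Qed.

(** The nearest kink on the left makes each term decay, relative to the
    dominant one, at rate [m] per [d] of slope difference.  The slopes are
    [d]-separated, so the terms are bounded by those of a geometric series. *)
Lemma sum_lower_slopes_lt a b d m y p : 0 < d -> separated a d -> 1 < m ->
  top_line a b y p ->
  (forall u, kinks a b u -> u <= y -> ln m / d <= y - u) ->
  \sum_(j < t | a j < a p) expR (a j * y + b j) < expR (a p * y + b p) / (m - 1).
Proof.
move=> d0 sep m1 topp far.
have m10 : 0 < m - 1 by rewrite subr_gt0.
have [q qp|none] := pickP (fun j => a j < a p); last first.
  by rewrite big_pred0 // divr_gt0 ?expR_gt0.
have [u [ku uy slope]] := nearest_kink_left (separated_inj d0 sep) topp qp.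
have yu := far u ku uy.
pose x j := (a p - a j) / d.
have x1 j : j \in [pred j | a j < a p] -> 1 <= x j.
  rewrite inE => jp; rewrite /x ler_pdivlMr // mul1r.
  have /sep : p != j by apply: contraTneq jp => ->; rewrite ltxx.
  by rewrite ger0_norm // subr_ge0 ltW.
have x_sep : {in [pred j | a j < a p] &, forall i j, i != j -> 1 <= `|x i - x j|}.
  move=> i j _ _ ij; rewrite /x -mulrBl normrM [`|d^-1|]gtr0_norm ?invr_gt0 //.
  rewrite ler_pdivlMr // mul1r (_ : _ - _ = a j - a i); last by ring.
  by rewrite distrC; apply: sep.
have := separated_sum_lt m1 x1 x_sep.
rewrite -(ltr_pM2l (expR_gt0 (a p * y + b p))); apply: le_lt_trans.
rewrite big_distrr /=; apply: ler_sum => j jp.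
rewrite -expRD ler_expR -lerBlDl lerNr opprB.
apply: le_trans (slope j jp); rewrite /x mulrA [leLHS]mulrAC mulrC ler_pM2l //.
by rewrite subr_gt0.
Qed.

Lemma sum_higher_slopes_lt a b d m y p : 0 < d -> separated a d -> 1 < m ->
  top_line a b y p ->
  (forall u, kinks a b u -> y <= u -> ln m / d <= u - y) ->
  \sum_(j < t | a p < a j) expR (a j * y + b j) < expR (a p * y + b p) / (m - 1).
Proof.
move=> d0 sep m1 topp far.
have := @sum_lower_slopes_lt (\- a) b d m (- y) p d0 (separated_opp sep) m1.
rewrite /= mulrNN.
under eq_bigl => j do rewrite /= ltrN2.
under eq_bigr => j _ do rewrite /= mulrNN.
apply; first exact/top_line_opp.
move=> u ku uy; have k : kinks a b (- u) by apply/kinks_opp; rewrite opprK.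
have yu : y <= - u by rewrite lerNr.
by have := far _ k yu; lra.
Qed.

Lemma dominates_sides a b y p : injective a ->
  \sum_(j < t | a j < a p) expR (a j * y + b j) +
  \sum_(j < t | a p < a j) expR (a j * y + b j) < expR (a p * y + b p) ->
  dominates a b y p.
Proof.
move=> ainj; apply: le_lt_trans.
rewrite (bigID (fun j => a j < a p)) /=; apply: lerD.
  rewrite big_mkcond [leRHS]big_mkcond; apply: ler_sum => j _.
  by case: ifP => [/andP[_ ->] //|_]; case: ifP; rewrite ?expR_ge0.
rewrite big_mkcond [leRHS]big_mkcond; apply: ler_sum => j _.
case: ifP => [/andP[jp]|_]; last by case: ifP; rewrite ?expR_ge0.
by case: ltgtP => // /ainj E; rewrite E eqxx in jp.
Qed.

(** With ratio [1/3] the lower slopes and the higher slopes contribute each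
    less than one half of the dominant term. *)
Lemma dominates_far_from_kinks a b d y (p0 : 'I_t) : 0 < d -> separated a d ->
  (forall u, kinks a b u -> ln 3 / d <= `|y - u|) -> exists p, dominates a b y p.
Proof.
move=> d0 sep far; have [p topp] := top_line_ex a b y p0; exists p.
have m1 : 1 < 3 :> R by lra.
apply: dominates_sides; first exact: separated_inj sep.
have lo := @sum_lower_slopes_lt a b d 3 y p d0 sep m1 topp.
have hi := @sum_higher_slopes_lt a b d 3 y p d0 sep m1 topp.
have {}lo := lo _; have {}hi := hi _.
apply: lt_le_trans (ltrD (lo _) (hi _)) _.
- by move=> u ku uy; rewrite -[y - u]ger0_norm ?subr_ge0 ?far.
- by move=> u ku yu; rewrite -[u - y]ger0_norm ?subr_ge0 // distrC far.
- by rewrite (_ : 3 - 1 = 2); lra.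
Qed.

(** To the right of all kinks the maximal line has the largest slope, so only
    the lower slopes contribute and the ratio [1/2] is enough. *)
Lemma dominates_right_of_kinks a b d y (p0 : 'I_t) : 0 < d -> separated a d ->
  (forall u, kinks a b u -> u + ln 2 / d <= y) -> exists p, dominates a b y p.
Proof.
move=> d0 sep far; have [p topp] := top_line_ex a b y p0; exists p.
have m1 : 1 < 2 :> R by lra.
have ainj := separated_inj d0 sep.
have l2 : 0 < ln 2 / d by rewrite divr_gt0 // ln_gt0.
apply: (dominates_sides ainj).
rewrite [X in _ + X]big_pred0 ?addr0; last first.
  move=> j; apply/negP => pj.
  have [u [ku yu _]] := nearest_kink_right ainj topp pj.
  have := far u ku; lra.
have := @sum_lower_slopes_lt a b d 2 y p d0 sep m1 topp.
rewrite (_ : 2 - 1 = 1) ?divr1; last by lra.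
by apply=> u ku _; have := far u ku; lra.
Qed.

Lemma dominates_left_of_kinks a b d y (p0 : 'I_t) : 0 < d -> separated a d ->
  (forall u, kinks a b u -> y <= u - ln 2 / d) -> exists p, dominates a b y p.
Proof.
move=> d0 sep far.
have [|p /dominates_opp domp] :=
  @dominates_right_of_kinks (\- a) b d (- y) p0 d0 (separated_opp sep).
  move=> u ku; have := far (- u).
  have : kinks a b (- u) by apply/kinks_opp; rewrite opprK.
  by move=> k /(_ k); lra.
by exists p.
Qed.

Lemma dominates_lt a b y p j : dominates a b y p -> j != p ->
  a j * y + b j < a p * y + b p.
Proof.
move=> dom jp; rewrite -ltr_expR; apply: le_lt_trans dom.
by rewrite (bigD1 j) //= lerDl sumr_ge0 // => i _; rewrite expR_ge0.
Qed.

(** Being below the line [p] at both ends of an interval is inherited by its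
    interior, so the maximum cannot be attained twice there. *)
Lemma dominates_no_kink a b y x u p :
  dominates a b y p -> dominates a b x p -> y <= u <= x -> ~ kinks a b u.
Proof.
move=> dy dx /andP[yu ux] ku.
have lt_u j : j != p -> a j * u + b j < a p * u + b p.
  move=> jp; have := dominates_lt dy jp; have := dominates_lt dx jp.
  have [|] := leP (a j) (a p) => h.
    have : 0 <= (a p - a j) * (u - y) by rewrite mulr_ge0 // subr_ge0.
    nra.
  have : 0 <= (a j - a p) * (x - u) by rewrite mulr_ge0 // subr_ge0 // ltW.
  nra.
case: ku => q [r [qr topq topr]].
have [qp|qp] := eqVneq q p.
  have := lt_u r; rewrite -qp eq_sym => /(_ qr); have := topr q.
  by rewrite leNgt => /negP.
by have := lt_u q qp; have := topq p; rewrite leNgt => /negP.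
Qed.

End Dominance.

(** * Angles of plane vectors *)

Section Polar.
Variable R : realType.
Implicit Types (u v th al : R).

(** The radius is left existential so that only angles have to be followed; the
    point is in particular not the origin. *)
Definition polar u v th : Prop :=
  exists r, [/\ 0 < r, u = r * cos th & v = r * sin th].

Lemma polar_ex u v : u ^+ 2 + v ^+ 2 != 0 -> exists th, polar u v th.
Proof.
move=> uv0.
have uvp : 0 < u ^+ 2 + v ^+ 2 by rewrite lt_neqAle eq_sym uv0 addr_ge0 ?sqr_ge0.
pose r := Num.sqrt (u ^+ 2 + v ^+ 2).
have r0 : 0 < r by rewrite sqrtr_gt0.
have r2 : r ^+ 2 = u ^+ 2 + v ^+ 2 by rewrite sqr_sqrtr // ltW.
have ur : -1 <= u / r <= 1.
  rewrite -ler_norml normrM [`|r^-1|]gtr0_norm ?invr_gt0 // ler_pdivrMr // mul1r.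
  rewrite -(ler_pXn2r (n := 2)) ?nnegrE ?normr_ge0 ?(ltW r0) //.
  by rewrite real_normK ?num_real // r2 lerDl sqr_ge0.
have ca : cos (acos (u / r)) = u / r by apply: acosK; rewrite in_itv.
have sa : sin (acos (u / r)) = `|v| / r.
  rewrite sin_acos // (_ : 1 - _ = (`|v| / r) ^+ 2).
    by rewrite sqrtr_sqr ger0_norm // divr_ge0 // ltW.
  rewrite !expr_div_n real_normK ?num_real // r2; field.
  by rewrite gt_eqF.
have [v0|v0] := leP 0 v.
  exists (acos (u / r)), r; rewrite ca sa ger0_norm //; split=> //.
    by rewrite mulrC divfK ?gt_eqF.
  by rewrite mulrC divfK ?gt_eqF.
exists (- acos (u / r)), r; rewrite cosN sinN ca sa ltr0_norm //; split=> //.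
  by rewrite mulrC divfK ?gt_eqF.
by rewrite mulNr opprK mulrC divfK ?gt_eqF.
Qed.

(** Signed angle from [(u, v)] to [(u', v')] when the two vectors make an acute
    angle: the arctangent of the cross product over the scalar product. *)
Definition step_angle u v u' v' : R :=
  atan ((u * v' - v * u') / (u * u' + v * v')).

Lemma polar_step u v u' v' al : polar u v al -> 0 < u * u' + v * v' ->
  polar u' v' (al + step_angle u v u' v').
Proof.
move=> [r [r0 uE vE]] dot0; rewrite /step_angle; set et := atan _.
have ce : 0 < cos et by apply: cos_gt0_pihalf; rewrite atan_gtNpi2 atan_ltpi2.
have se : sin et * (u * u' + v * v') = (u * v' - v * u') * cos et.
  have : tan et = (u * v' - v * u') / (u * u' + v * v') by rewrite /et atanK.
  rewrite /tan => /eqP; rewrite eqr_div ?(gt_eqF ce) ?(gt_eqF dot0) //.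
  by move=> /eqP.
have cs : cos al ^+ 2 + sin al ^+ 2 = 1 by rewrite cos2Dsin2.
exists ((u * u' + v * v') / (r * cos et)); split.
- by rewrite divr_gt0 // mulr_gt0.
- transitivity (((u * u' + v * v') * cos al * cos et -
      sin al * (sin et * (u * u' + v * v'))) / (r * cos et)).
    rewrite se uE vE -[LHS]mulr1 -cs; field.
    by rewrite !gt_eqF.
  by rewrite cosD; field; rewrite !gt_eqF.
- transitivity (((u * u' + v * v') * sin al * cos et +
      cos al * (sin et * (u * u' + v * v'))) / (r * cos et)).
    rewrite se uE vE -[LHS]mulr1 -cs; field.
    by rewrite !gt_eqF.
  by rewrite sinD; field; rewrite !gt_eqF.
Qed.

Lemma polar_cos_gt0 u v u' v' al al' : polar u v al -> polar u' v' al' ->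
  0 < u * u' + v * v' -> 0 < cos (al' - al).
Proof.
move=> [r [r0 -> ->]] [r' [r'0 -> ->]].
rewrite (_ : _ + _ = r * r' * cos (al' - al)); last by rewrite cosB; ring.
by rewrite pmulr_rgt0 // mulr_gt0.
Qed.

(** A continuous angle whose cosine stays positive cannot travel by [pi]: it
    would pass through a value whose cosine is opposite to the initial one.
    This replaces all bookkeeping of angles modulo [2 pi]. *)
Lemma cos_gt0_variation (f : R -> R) (s t : R) : s <= t ->
  {in `[s, t], forall x, {for x, continuous f}} ->
  {in `[s, t], forall x, 0 < cos (f x)} -> `|f t - f s| < pi.
Proof.
move=> st cf pf.
have cw : {within `[s, t], continuous f} 
  by apply: continuous_in_subspaceT => x; rewrite inE; exact: cf.
have sin0 : s \in `[s, t]%R by rewrite in_itv /= lexx st.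
have tin0 : t \in `[s, t]%R by rewrite in_itv /= lexx st.
have key (e : R) : cos (f s + e) = - cos (f s) ->
    ~~ (Num.min (f s) (f t) <= f s + e <= Num.max (f s) (f t)).
  move=> he; apply/negP => /(IVT st cw)[x xin fx].
  have := pf x xin; rewrite fx he oppr_gt0.
  by apply/negP; rewrite -leNgt ltW // pf.
rewrite ltNge; apply/negP => h.
have pi0 := pi_gt0 R.
have [fst|fts] := leP (f s) (f t).
  move: h; rewrite ger0_norm ?subr_ge0 // => h.
  have /negP := key pi (cosDpi _); apply.
  by rewrite (min_l fst) (max_r fst); lra.
move: h; rewrite ltr0_norm ?subr_lt0 // => h.
have /key/negP : cos (f s + - pi) = - cos (f s) by rewrite -[f s in RHS](subrK pi) cosDpi opprK.
apply.
by rewrite (min_r (ltW fts)) (max_l (ltW fts)); lra.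
Qed.

End Polar.

Section CosLipschitz.
Variable R : realType.
Implicit Types (u v : R).

Lemma cos_lipschitz u v : `|cos u - cos v| <= `|u - v|.
Proof.
wlog uv : u v / v <= u => [H|].
  by have [|/ltW] := leP v u => h; [exact: H|rewrite distrC [leRHS]distrC; exact: H].
have [x _ ->] := @MVT_segment R cos (fun x => - sin x) v u uv
  (fun x _ => is_derive_cos x) (continuous_subspaceT (@continuous_cos R)).
rewrite normrM normrN -[leRHS]mul1r ler_wpM2r // ler_norml.
by rewrite sin_geN1 sin_le1.
Qed.

Lemma sin_lipschitz u v : `|sin u - sin v| <= `|u - v|.
Proof.
rewrite -!cosBpihalf; apply: le_trans (cos_lipschitz _ _) _.
by have -> : u - pi / 2 - (v - pi / 2) = u - v by ring.
Qed.

Lemma cosD_int2pi u (m : int) : cos (u + m%:~R * (pi *+ 2)) = cos u.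
Proof.
have nat_per (n : nat) (w : R) : cos (w + n%:R * (pi *+ 2)) = cos w.
  by rewrite mulr_natl (periodicn (@cosD2pi R)).
case: m => n; first exact: nat_per.
by rewrite NegzE mulrNz mulNr -(nat_per n.+1) subrK.
Qed.

Lemma sinD_int2pi u (m : int) : sin (u + m%:~R * (pi *+ 2)) = sin u.
Proof. by rewrite -!cosBpihalf addrAC cosD_int2pi. Qed.

End CosLipschitz.

(** * Turning of plane curves *)

Section Winding.
Variable R : realType.

Lemma sum_continuous_at (T : topologicalType) n (F : 'I_n -> T -> R) (z : T) :
  (forall i, {for z, continuous (F i)}) ->
  {for z, continuous (fun w => \sum_(i < n) F i w)}.
Proof.
move=> cF; rewrite /prop_for /continuous_at.
by apply: cvg_big => //; [exact: add_continuous|move=> i _; exact: cF].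
Qed.

Definition mesh_point n (s : R) k : R := s * (k%:R / n%:R).

(** Total angle swept by the curve [(U, V)] on [[0, s]], computed from [n] equal
    steps.  The mesh scales with [s], so that for a fixed [n] the value is a
    continuous function of [s] and of any parameter on which the curve
    depends: this is a continuous choice of the argument. *)
Definition turning (U V : R -> R) n (s : R) : R :=
  \sum_(k < n) step_angle (U (mesh_point n s k)) (V (mesh_point n s k))
                          (U (mesh_point n s k.+1)) (V (mesh_point n s k.+1)).

Definition fine_mesh (U V : R -> R) n (s : R) : Prop :=
  forall k, (k < n)%N ->
   0 < U (mesh_point n s k) * U (mesh_point n s k.+1)
     + V (mesh_point n s k) * V (mesh_point n s k.+1).

Lemma polar_turning U V n s al : (0 < n)%N -> fine_mesh U V n s ->
  polar (U 0) (V 0) al -> polar (U s) (V s) (al + turning U V n s).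
Proof.
move=> n0 fine pol0.
have partial m : (m <= n)%N ->
    polar (U (mesh_point n s m)) (V (mesh_point n s m))
     (al + \sum_(k < m) step_angle (U (mesh_point n s k)) (V (mesh_point n s k))
                         (U (mesh_point n s k.+1)) (V (mesh_point n s k.+1))).
  elim: m => [|m IH] mn; first by rewrite big_ord0 addr0 /mesh_point mul0r mulr0.
  rewrite big_ord_recr /= addrA; apply: polar_step; first exact: (IH (ltnW mn)).
  exact: fine.
have := partial n (leqnn n).
by rewrite /mesh_point divff ?mulr1 // pnatr_eq0 -lt0n.
Qed.

Lemma turning0 U V n : turning U V n 0 = 0.
Proof.
rewrite /turning big1 // => k _; rewrite /step_angle /mesh_point !mul0r.
by rewrite [V 0 * _]mulrC subrr mul0r atan0.
Qed.

(** The endpoint [s] and the curve vary together with a parameter [w], which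
    covers both moving along a curve and moving from one curve to the next. *)
Lemma turning_continuous (T : topologicalType) (U V : T -> R -> R) (s : T -> R) n z :
  (forall r, {for z, continuous (fun w => U w (s w * r))}) ->
  (forall r, {for z, continuous (fun w => V w (s w * r))}) ->
  fine_mesh (U z) (V z) n (s z) ->
  {for z, continuous (fun w => turning (U w) (V w) n (s w))}.
Proof.
move=> cU cV fine; apply: sum_continuous_at => k.
apply: (@continuous_comp _ _ _ _ (@atan R)); last exact: continuous_atan.
apply: cvgM.
  by apply: cvgB; apply: cvgM; [exact: cU|exact: cV|exact: cV|exact: cU].
apply: cvgV; first by rewrite gt_eqF //; exact: fine.
by apply: cvgD; apply: cvgM; [exact: cU|exact: cU|exact: cV|exact: cV].
Qed.

(** If the curve stays within a right angle of a uniform rotation of speed [A],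
    their angles differ by a continuous function whose cosine is positive, so
    the difference changes by less than [pi]. *)
Lemma turning_rate (U V : R -> R) n (T A be : R) : (0 < n)%N -> 0 <= T ->
  continuous U -> continuous V ->
  (forall s, 0 <= s <= T -> fine_mesh U V n s) ->
  (forall s, 0 <= s <= T -> 0 < cos (A * s + be) * U s + sin (A * s + be) * V s) ->
  `|turning U V n T - A * T| < pi.
Proof.
move=> n0 T0 cU cV fine follow.
have Tin : 0 <= T <= T by rewrite T0 lexx.
have zin : 0 <= (0 : R) <= T by rewrite lexx T0.
have [al pol0] : exists al, polar (U 0) (V 0) al.
  apply: polar_ex; have := fine 0 zin 0%N n0; rewrite /mesh_point !mul0r -!expr2.
  by move/lt0r_neq0.
have dir (th : R) : polar (cos th) (sin th) th by exists 1; split; rewrite ?mul1r.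
have -> : turning U V n T - A * T =
    (al + turning U V n T - (A * T + be)) - (al + turning U V n 0 - (A * 0 + be)).
  by rewrite turning0; ring.
apply: (cos_gt0_variation (f := fun s => al + turning U V n s - (A * s + be)) T0).
  move=> s; rewrite in_itv /= => s_in.
  apply: cvgB.
    apply: cvgD; first exact: cvg_cst.
    apply: (@turning_continuous R (fun=> U) (fun=> V) id n s).
    - by move=> r; apply: continuous_comp; [exact: mulrr_continuous|exact: cU].
    - by move=> r; apply: continuous_comp; [exact: mulrr_continuous|exact: cV].
    - exact: fine.
  by apply: cvgD; [exact: mulrl_continuous|exact: cvg_cst].
move=> s; rewrite in_itv /= => s_in; rewrite /=.
exact: (polar_cos_gt0 (dir _) (polar_turning n0 (fine s s_in) pol0) (follow s s_in)).
Qed.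

(** Discrete form of the argument principle on the rectangle [[c, d] x [0, T]].
    The turning along [x] constant varies continuously with [x] and, since
    both ends of the curve make an acute angle, by less than [pi] in total; on
    the two vertical sides it is [A T] and [A' T] up to [pi]. *)
Lemma strip_winding (U V : R -> R -> R) n (c d T A A' be be' : R) :
  (0 < n)%N -> c <= d -> 0 <= T ->
  (forall x, continuous (U x)) -> (forall x, continuous (V x)) ->
  (forall y, continuous (U ^~ y)) -> (forall y, continuous (V ^~ y)) ->
  (forall x s, c <= x <= d -> 0 <= s <= T -> fine_mesh (U x) (V x) n s) ->
  (forall x, c <= x <= d -> 0 < U x 0 * U x T + V x 0 * V x T) ->
  (forall s, 0 <= s <= T -> 0 < cos (A * s + be) * U c s + sin (A * s + be) * V c s) ->
  (forall s, 0 <= s <= T -> 0 < cos (A' * s + be') * U d s + sin (A' * s + be') * V d s) ->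
  `|A - A'| * T < pi *+ 3.
Proof.
move=> n0 cd T0 cU cV cU' cV' fine close followc followd.
have cin : c <= c <= d by rewrite lexx.
have din : c <= d <= d by rewrite lexx andbT.
have Tin : 0 <= T <= T by rewrite T0 lexx.
have := turning_rate n0 T0 (cU c) (cV c) (fun s => fine c s cin) followc.
have := turning_rate n0 T0 (cU d) (cV d) (fun s => fine d s din) followd.
have : `|turning (U d) (V d) n T - turning (U c) (V c) n T| < pi.
  apply: (cos_gt0_variation (f := fun x => turning (U x) (V x) n T) cd).
    move=> x; rewrite in_itv /= => xin.
    apply: (@turning_continuous R U V (fun=> T) n x).
    - by move=> r; exact: cU'.
    - by move=> r; exact: cV'.
    - exact: fine.
  move=> x; rewrite in_itv /= => xin.
  have [al pol0] : exists al, polar (U x 0) (V x 0) al.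
    apply: polar_ex; apply/negP => /eqP z; have := close x xin.
    have : 0 <= U x 0 ^+ 2 by exact: sqr_ge0.
    have : 0 <= V x 0 ^+ 2 by exact: sqr_ge0.
    move=> h1 h2; have u0 : U x 0 = 0 by apply/eqP; rewrite -sqrf_eq0; apply/eqP; lra.
    have v0 : V x 0 = 0 by apply/eqP; rewrite -sqrf_eq0; apply/eqP; lra.
    by rewrite u0 v0 !mul0r addr0 ltxx.
  have polT := polar_turning n0 (fine x T xin Tin) pol0.
  have := polar_cos_gt0 pol0 polT (close x xin).
  by rewrite addrAC subrr add0r.
have -> : `|A - A'| * T = `|A * T - A' * T| by rewrite -mulrBl normrM (ger0_norm T0).
rewrite !ltr_norml.
by move=> /andP[? ?] /andP[? ?] /andP[? ?]; rewrite -mulr_natr; apply/andP; split; lra.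
Qed.

End Winding.

(** * Roots between two dominant terms *)

Section Roots.
Variables (R : realType) (t : nat).
Implicit Types (a b g : 'I_t -> R).

(** Dirichlet's simultaneous approximation: among sufficiently many multiples of
    [tau], two give phases in the same small box modulo [2 pi], and [T] is
    their difference. *)
Lemma common_near_period a (tau eps : R) : 0 < tau -> 0 < eps ->
  exists2 T : R, tau <= T & forall j, exists m : int, `|a j * T - m%:~R * (pi *+ 2)| <= eps.
Proof.
move=> tau0 eps0.
have pi2 : 0 < (pi : R) *+ 2 by rewrite pmulrn_lgt0 // pi_gt0.
(* The circle is cut into K arcs of length at most eps. *)
pose K := (Num.truncn (pi *+ 2 / eps)).+1.
have K0 : 0 < K%:R :> R by rewrite ltr0n.
have Keps : pi *+ 2 / K%:R <= eps.
  rewrite ler_pdivrMr // mulrC -ler_pdivrMr // ltW //; exact: truncnS_gt.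
pose ph (n : nat) j : R := a j * (n%:R * tau) / (pi *+ 2).
pose fr n j : R := ph n j - (Num.floor (ph n j))%:~R.
have fr01 n j : 0 <= fr n j < 1.
  by have := floor_itv (ph n j); rewrite intrD /fr => /andP[? ?]; apply/andP; split; lra.
have boxP n j : (Num.truncn (K%:R * fr n j) < K)%N.
  have /andP[f0 f1] := fr01 n j.
  rewrite truncn_lt_nat; last by rewrite mulr_ge0 // ltW.
  by rewrite -[ltRHS]mulr1 ltr_pM2l.
pose box n : {ffun 'I_t -> 'I_K} := [ffun j => Ordinal (boxP n j)].
have [m [n [mn E]]] : exists m n : nat, (m < n)%N /\ box m = box n.
  pose f (n : 'I_(K ^ t).+1) := box n.
  have /injectivePn[x [y xy E]] : ~~ injectiveb f.
    apply/negP => /injectiveP/leq_card.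
    by rewrite card_ffun !card_ord ltnn.
  have : (x < y)%N || (y < x)%N by rewrite -neq_ltn; exact: xy.
  by case/orP=> h; [exists x, y|exists y, x].
exists ((n - m)%:R * tau).
  by rewrite -[leLHS]mul1r ler_pM2r // ler1n subn_gt0.
move=> j; exists (Num.floor (ph n j) - Num.floor (ph m j)).
have : `|fr n j - fr m j| * K%:R <= 1.
  have := congr1 (fun h : {ffun 'I_t -> 'I_K} => val (h j)) E; rewrite !ffunE /= => Ej.
  have trB k : (Num.truncn (K%:R * fr k j))%:R <= K%:R * fr k j
      < (Num.truncn (K%:R * fr k j)).+1%:R.
    by apply: truncn_itv; rewrite mulr_ge0 ?ler0n //; case/andP: (fr01 k j).
  rewrite -[X in _ * X](ger0_norm (ltW K0)) -normrM.
  have := trB m; have := trB n; rewrite Ej -natr1 => /andP[? ?] /andP[? ?].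
  by rewrite ler_norml; apply/andP; split; lra.
rewrite -ler_pdivlMr // mul1r => close; apply: le_trans Keps.
have -> : a j * ((n - m)%:R * tau) -
    (Num.floor (ph n j) - Num.floor (ph m j))%:~R * (pi *+ 2) =
    (pi *+ 2) * (fr n j - fr m j).
  rewrite /fr /ph intrB natrB 1?ltnW //.
  by move: (lt0r_neq0 pi2); move: (pi *+ 2) => P P0; field.
by rewrite normrM (gtr0_norm pi2) ler_pM2l.
Qed.

(** Real and imaginary parts of a sum of exponentials at abscissa [x], with the
    phases left free: only small changes of the phases matter below. *)
Definition re_sum a b x (ph : 'I_t -> R) : R :=
  \sum_(j < t) expR (a j * x + b j) * cos (ph j).
Definition im_sum a b x (ph : 'I_t -> R) : R :=
  \sum_(j < t) expR (a j * x + b j) * sin (ph j).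

(** The function [h] stands for [cos] or [sin]. *)
Lemma sum_near_phase (X : 'I_t -> R) (h : R -> R) (ph ph' : 'I_t -> R) (B eps : R) :
  (forall u v, `|h u - h v| <= `|u - v|) ->
  (forall u (m : int), h (u + m%:~R * (pi *+ 2)) = h u) ->
  (forall j, 0 <= X j) -> \sum_(j < t) X j <= B -> 0 <= eps ->
  (forall j, exists m : int, `|ph' j - ph j - m%:~R * (pi *+ 2)| <= eps) ->
  `|\sum_(j < t) X j * h (ph' j) - \sum_(j < t) X j * h (ph j)| <= B * eps.
Proof.
move=> lip per X0 XB eps0 near.
apply: (@le_trans _ _ (\sum_(j < t) X j * eps)); last first.
  by rewrite -mulr_suml ler_wpM2r.
rewrite -sumrB; apply: le_trans (ler_norm_sum _ _ _) _; apply: ler_sum => j _.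
rewrite -mulrBr normrM (ger0_norm (X0 j)) ler_wpM2l //.
have [m hm] := near j; apply: le_trans hm.
by rewrite -(per (ph j) m) -addrA -opprD; exact: lip.
Qed.

Lemma sum_trig_le (X : 'I_t -> R) (h : R -> R) (ph : 'I_t -> R) (B : R) :
  (forall u, `|h u| <= 1) -> (forall j, 0 <= X j) -> \sum_(j < t) X j <= B ->
  `|\sum_(j < t) X j * h (ph j)| <= B.
Proof.
move=> h1 X0; apply: le_trans; apply: le_trans (ler_norm_sum _ _ _) _.
apply: ler_sum => j _; rewrite normrM (ger0_norm (X0 j)).
by rewrite -[leRHS]mulr1 ler_wpM2l.
Qed.

(** A sum bounded away from the origin keeps its direction, up to a right angle,
    when all phases are moved by a small amount modulo [2 pi]. *)
Lemma near_phase_dot_gt0 a b x (ph ph' : 'I_t -> R) (B eps mu : R) :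
  \sum_(j < t) expR (a j * x + b j) <= B -> 0 <= eps ->
  B * B * eps * 2 < mu ->
  mu <= re_sum a b x ph ^+ 2 + im_sum a b x ph ^+ 2 ->
  (forall j, exists m : int, `|ph' j - ph j - m%:~R * (pi *+ 2)| <= eps) ->
  0 < re_sum a b x ph * re_sum a b x ph' + im_sum a b x ph * im_sum a b x ph'.
Proof.
move=> XB eps0 small mule near.
have X0 j : 0 <= expR (a j * x + b j) by exact: expR_ge0.
have cos1 (u : R) : `|cos u| <= 1 by rewrite ler_norml cos_geN1 cos_le1.
have sin1 (u : R) : `|sin u| <= 1 by rewrite ler_norml sin_geN1 sin_le1.
have := sum_near_phase (@cos_lipschitz R) (@cosD_int2pi R) X0 XB eps0 near.
have := sum_near_phase (@sin_lipschitz R) (@sinD_int2pi R) X0 XB eps0 near.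
have := sum_trig_le ph cos1 X0 XB; have := sum_trig_le ph sin1 X0 XB.
rewrite -/(re_sum a b x ph) -/(im_sum a b x ph) -/(re_sum a b x ph') -/(im_sum a b x ph').
move: (re_sum _ _ _ _) (im_sum _ _ _ _) (re_sum _ _ _ _) (im_sum _ _ _ _) mule.
move=> u' v' u v mule vB uB dv du.
have B0 : 0 <= B by apply: le_trans uB; exact: normr_ge0.
have eu : `|u * (u' - u)| <= B * (B * eps) by rewrite normrM ler_pM.
have ev : `|v * (v' - v)| <= B * (B * eps) by rewrite normrM ler_pM.
move: eu ev small; rewrite !ler_norml => /andP[? ?] /andP[? ?] ?.
nra.
Qed.

Lemma exp_line_continuous a b j (T : topologicalType) (X : T -> R) (z : T) :
  {for z, continuous X} -> {for z, continuous (fun w => expR (a j * X w + b j))}.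
Proof.
move=> cX; apply: (@continuous_comp _ _ _ _ (@expR R)); last exact: continuous_expR.
by apply: cvgD; [apply: cvgM; [exact: cvg_cst|exact: cX]|exact: cvg_cst].
Qed.

Lemma phase_continuous a g (h : R -> R) j (T : topologicalType) (Y : T -> R) (z : T) :
  continuous h ->
  {for z, continuous Y} -> {for z, continuous (fun w => h (a j * Y w + g j))}.
Proof.
move=> ch cY; apply: (@continuous_comp _ _ _ _ h); last exact: ch.
by apply: cvgD; [apply: cvgM; [exact: cvg_cst|exact: cY]|exact: cvg_cst].
Qed.

Lemma re_sum_continuous a b g (T : topologicalType) (X Y : T -> R) (z : T) :
  {for z, continuous X} -> {for z, continuous Y} ->
  {for z, continuous (fun w => re_sum a b (X w) (fun j => a j * Y w + g j))}.
Proof.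
move=> cX cY; apply: sum_continuous_at => j; apply: cvgM.
  exact: exp_line_continuous.
exact: phase_continuous (@continuous_cos R) cY.
Qed.

Lemma im_sum_continuous a b g (T : topologicalType) (X Y : T -> R) (z : T) :
  {for z, continuous X} -> {for z, continuous Y} ->
  {for z, continuous (fun w => im_sum a b (X w) (fun j => a j * Y w + g j))}.
Proof.
move=> cX cY; apply: sum_continuous_at => j; apply: cvgM.
  exact: exp_line_continuous.
exact: phase_continuous (@continuous_sin R) cY.
Qed.

(** The sum is the dominant term plus a vector shorter than it, hence makes an
    acute angle with the dominant term, and in particular is nonzero. *)
Lemma dominates_dot_gt0 a b x p (ph : 'I_t -> R) : dominates a b x p ->
  0 < cos (ph p) * re_sum a b x ph + sin (ph p) * im_sum a b x ph.
Proof.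
move=> dom; rewrite /re_sum /im_sum !mulr_sumr -big_split /=.
rewrite (eq_bigr (fun j => expR (a j * x + b j) * cos (ph j - ph p))); last first.
  by move=> j _; rewrite cosB; ring.
rewrite (bigD1 p) //= subrr cos0 mulr1.
apply: lt_le_trans (lerD (lexx _) (_ : - \sum_(j < t | j != p) expR (a j * x + b j) <= _)).
  by rewrite subr_gt0.
rewrite -sumrN; apply: ler_sum => j _.
by rewrite -[leLHS]mulr1 mulNr -mulrN ler_wpM2l ?expR_ge0 ?cos_geN1.
Qed.

Lemma norm_sum_min a b g (c d T : R) : c <= d -> 0 <= T ->
  (forall x y : R, c <= x <= d ->
    re_sum a b x (fun j => a j * y + g j) ^+ 2 +
    im_sum a b x (fun j => a j * y + g j) ^+ 2 != 0) ->
  exists2 mu : R, 0 < mu & forall x y : R, c <= x <= d -> 0 <= y <= T ->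
    mu <= re_sum a b x (fun j => a j * y + g j) ^+ 2 +
          im_sum a b x (fun j => a j * y + g j) ^+ 2.
Proof.
move=> cd T0 nz.
pose f (z : R * R) := re_sum a b z.1 (fun j => a j * z.2 + g j) ^+ 2 +
          im_sum a b z.1 (fun j => a j * z.2 + g j) ^+ 2.
have cf : continuous f.
  move=> z; rewrite /f.
  have c1 : {for z, continuous (fun w : R * R => w.1)} by exact: cvg_fst.
  have c2 : {for z, continuous (fun w : R * R => w.2)} by exact: cvg_snd.
  have cR := re_sum_continuous (a := a) (b := b) (g := g) c1 c2.
  have cI := im_sum_continuous (a := a) (b := b) (g := g) c1 c2.
  by apply: cvgD; apply: cvgM; [exact: cR|exact: cR|exact: cI|exact: cI].
have ne : (`[c, d] `*` `[0, T])%classic !=set0.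
  by exists (c, 0); split; rewrite /= in_itv /= lexx.
have [[x0 y0]] := compact_EVT_min ne
  (compact_setX (@segment_compact _ c d) (@segment_compact _ 0 T))
  (continuous_subspaceT cf).
rewrite inE /= !in_itv /= => -[x0in y0in] fmin.
exists (f (x0, y0)).
  by rewrite lt_neqAle eq_sym nz // addr_ge0 ?sqr_ge0.
move=> x y xin yin; apply: (fmin (x, y)).
by rewrite inE /= !in_itv.
Qed.

Lemma exp_sum_bounded a b (c d : R) : c <= d ->
  exists2 B : R, 1 <= B & forall x : R, c <= x <= d -> \sum_(j < t) expR (a j * x + b j) <= B.
Proof.
move=> cd.
have cF : continuous (fun x : R => \sum_(j < t) expR (a j * x + b j)).
  by move=> x; apply: sum_continuous_at => j; apply: exp_line_continuous; exact: cvg_id.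
have [m _ Hm] := EVT_max cd (continuous_subspaceT cF).
exists (Num.max 1 (\sum_(j < t) expR (a j * m + b j))); first by rewrite le_max lexx.
by move=> x xin; rewrite le_max Hm ?orbT // in_itv.
Qed.

(** Suppose there is no root.  Choose [T] so long that rotations at speeds [a p]
    and [a q] differ by at least [3 pi] after time [T], and such that all
    phases almost return at time [T], so that each vertical segment carries an
    almost closed curve.  On the sides of the rectangle the sum follows its
    dominant terms, which contradicts [strip_winding]. *)
Lemma root_between_dominants a b g (c d : R) p q : c <= d -> injective a -> p != q ->
  dominates a b c p -> dominates a b d q ->
  exists x y, [/\ c < x < d, re_sum a b x (fun j => a j * y + g j) = 0
    & im_sum a b x (fun j => a j * y + g j) = 0].
Proof.
move=> cd ainj pq domp domq; apply: contrapT => noroot.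
have nz x y : c <= x <= d ->
    re_sum a b x (fun j => a j * y + g j) ^+ 2 +
    im_sum a b x (fun j => a j * y + g j) ^+ 2 != 0.
  move=> /andP[cx xd]; apply/negP; rewrite paddr_eq0 ?sqr_ge0 // !sqrf_eq0.
  move=> /andP[/eqP re0 /eqP im0]; apply: noroot; exists x, y; split=> //.
  have boundary r k : dominates a b r k -> x != r.
    move=> dom; apply: contraPneq (@dominates_dot_gt0 a b r k (fun j => a j * y + g j) dom).
    by move=> <-; rewrite re0 im0 !mulr0 addr0 ltxx.
  by rewrite !lt_neqAle cx xd eq_sym (boundary c p domp) (boundary d q domq).
have [B B1 HB] := exp_sum_bounded a b cd.
have B0 : 0 < B by apply: lt_le_trans B1.
have BB : 0 < B * B * 4 by rewrite !mulr_gt0.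
(* A phase tolerance of mu / (4 B^2) is what near_phase_dot_gt0 asks for. *)
have small mu : 0 < mu -> B * B * (mu / (B * B * 4)) * 2 < mu.
  move=> mu0; have -> : B * B * (mu / (B * B * 4)) * 2 = mu / 2.
    by field; rewrite gt_eqF.
  by lra.
have [mu0 mu00 Hmu0] := norm_sum_min cd (lexx 0) nz.
pose gap : R := `|a p - a q|.
have gap0 : 0 < gap.
  by rewrite normr_gt0 subr_eq0; apply: contra pq => /eqP/ainj ->.
have tau0 : 0 < (pi : R) *+ 3 / gap by rewrite divr_gt0 // pmulrn_lgt0 // pi_gt0.
have [T tauT retT] := common_near_period a tau0 (divr_gt0 mu00 BB).
have T0 : 0 < T by apply: lt_le_trans tauT.
have [mu mu_0 Hmu] := norm_sum_min cd (ltW T0) nz.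
pose eps : R := mu / (B * B * 4).
have eps0 : 0 < eps by rewrite divr_gt0.
pose S : R := \sum_(j < t) `|a j| * T / eps.
(* With n steps every phase moves by at most eps between two mesh points. *)
pose n := (Num.truncn S).+1.
have n0 : 0 < n%:R :> R by rewrite ltr0n.
have nS j : `|a j| * T / n%:R <= eps.
  rewrite ler_pdivrMr // [leRHS]mulrC -ler_pdivrMr //; apply: le_trans (ltW (truncnS_gt S)).
  rewrite /S (bigD1 j) //= lerDl sumr_ge0 // => i _.
  by apply: divr_ge0 (ltW eps0); apply: mulr_ge0 (ltW T0).
have meshT : pi *+ 3 <= `|a p - a q| * T by rewrite mulrC -ler_pdivrMr.
have per0 (r : R) : r - 0%:~R * (pi *+ 2) = r by rewrite mul0r subr0.
have idc z : {for z, continuous (fun w : R => w)} by exact: cvg_id.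
have cstc (v z : R) : {for z, continuous (fun _ : R => v)} by exact: cvg_cst.
suff : `|a p - a q| * T < pi *+ 3 by rewrite ltNge meshT.
apply: (@strip_winding R (fun x y => re_sum a b x (fun j => a j * y + g j))
  (fun x y => im_sum a b x (fun j => a j * y + g j)) (Num.truncn S).+1 c d T _ _ (g p) (g q)
  isT cd (ltW T0)).
- by move=> x y; apply: re_sum_continuous.
- by move=> x y; apply: im_sum_continuous.
- by move=> y x; apply: re_sum_continuous.
- by move=> y x; apply: im_sum_continuous.
- move=> x s xin /andP[s0 sT] k kn.
  apply: (near_phase_dot_gt0 (HB x xin) (ltW eps0) (small mu mu_0)).
    apply: Hmu => //; rewrite mulr_ge0 ?divr_ge0 ?ler0n //=.
    apply: le_trans sT; rewrite -[leRHS]mulr1 ler_wpM2l // ler_pdivrMr // mul1r ler_nat.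
    exact: ltnW.
  move=> j; exists 0; rewrite per0.
  have -> : a j * mesh_point n s k.+1 + g j - (a j * mesh_point n s k + g j) =
      a j * s / n%:R by rewrite /mesh_point -natr1; ring.
  apply: le_trans (nS j); rewrite !normrM [`|n%:R^-1|]gtr0_norm ?invr_gt0 //.
  by rewrite (ger0_norm s0) ler_wpM2r ?invr_ge0 ?(ltW n0) // ler_wpM2l.
- move=> x xin; apply: (near_phase_dot_gt0 (HB x xin) _ (small mu0 mu00)).
  + by rewrite ltW // divr_gt0.
  + by apply: Hmu0 => //; rewrite lexx.
  + move=> j; have [m hm] := retT j; exists m.
    by rewrite mulr0 add0r addrK.
- by move=> s _; exact: dominates_dot_gt0.
- by move=> s _; exact: dominates_dot_gt0.
Qed.

End Roots.

(** * Logarithms of small integers *)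

Section Numerics.
Variable R : realType.

Lemma expR_ge_partial_sum (x : R) n : 0 <= x ->
  \sum_(k < n) x ^+ k / k`!%:R <= expR x.
Proof.
move=> x0; rewrite -(big_mkord xpredT (fun k => x ^+ k / k`!%:R)).
apply: (nondecreasing_cvgn_le (u_ := series (exp_coeff x))); last exact: is_cvg_series_exp_coeff.
by apply: nondecreasing_series => k _ _; exact: exp_coeff_ge0.
Qed.

Lemma ln3_lt : ln 3 < 11 / 10 :> R.
Proof.
rewrite -ltr_expR lnK ?posrE //.
have x0 : 0 <= 11 / 10 :> R by lra.
apply: lt_le_trans (expR_ge_partial_sum 6 x0).
rewrite !big_ord_recr big_ord0 /= !factS fact0; lra.
Qed.

Lemma ln6_lt : ln 6 < 18 / 10 :> R.
Proof.
rewrite -ltr_expR lnK ?posrE //.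
have x0 : 0 <= 18 / 10 :> R by lra.
apply: lt_le_trans (expR_ge_partial_sum 7 x0).
rewrite !big_ord_recr big_ord0 /= !factS fact0; lra.
Qed.

Lemma ln_bounds : [/\ ln 9 = 2 * ln 3 :> R, ln (9 / 2) = 2 * ln 3 - ln 2 :> R,
  ln (81 / 2) = 4 * ln 3 - ln 2 :> R & 2 * ln 3 + ln 2 < 29 / 10 :> R].
Proof.
have l9 : ln 9 = 2 * ln 3 :> R by rewrite mulr_natl -lnXn //; congr ln; ring.
have l81 : ln 81 = 4 * ln 3 :> R by rewrite mulr_natl -lnXn //; congr ln; ring.
have l6 : ln 6 = ln 3 + ln 2 :> R by rewrite -lnM ?posrE //; congr ln; ring.
split=> //; rewrite ?ln_div ?posrE ?l9 ?l81 //.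
have := ln3_lt; have := ln6_lt; rewrite l6; lra.
Qed.

(** The last inequality holds for [t = 3], where it says [ln 18 < 29 / 10], and
    its defect grows with [t] because [ln 9 < 22 / 10]. *)
Lemma root_distance_bounds (s t : nat) (d : R) : 0 < d -> (3 <= t)%N -> (s <= t - 1)%N ->
  [/\ ln 9 * s%:R - ln (9 / 2) = 2 * ln 3 * (s%:R - 1) + ln 2 :> R,
      (ln 9 * s%:R - ln (9 / 2)) / d <= (ln 9 * t%:R - ln (81 / 2)) / d
    & (ln 9 * t%:R - ln (81 / 2)) / d < (22 / 10 * t%:R - 37 / 10) / d].
Proof.
move=> d0 t3 st; have [-> -> -> l18] := ln_bounds; have l3 := ln3_lt.
have l3p : 0 < ln 3 :> R by rewrite ln_gt0 // ltr1n.
have t3R : 3 <= t%:R :> R by rewrite ler_nat.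
have stR : s%:R + 1 <= t%:R :> R.
  by rewrite natr1 ler_nat; apply: leq_ltn_trans st _; rewrite subn1 prednK // (leq_trans _ t3).
split; first by ring.
  rewrite ler_pM2r ?invr_gt0 //.
  have : 0 <= (ln 3 : R) * (t%:R - (s%:R + 1)) by rewrite mulr_ge0 ?(ltW l3p) // subr_ge0.
  lra.
rewrite ltr_pM2r ?invr_gt0 //.
have : 0 <= (11 / 10 - ln 3 : R) * (t%:R - 3) by rewrite mulr_ge0 // subr_ge0 // (ltW l3).
lra.
Qed.

End Numerics.

(** * Chains of intervals and components of open sets *)

Section Clusters.
Variable R : realType.
Implicit Types (K : set R) (u x y r e : R).

(** If [[u, x]] were longer, the points [u + (2 k - 1) r] with [0 < k < s] would
    lie in it, each within [r] of a point of [K].  These points of [K] lie in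
    disjoint intervals to the right of [u], and [K] also has a point beyond all
    of them because [x < sup K + e].  Together with [u] this makes [s + 1]
    points. *)
Lemma ball_chain_lt_sup K (s : nat) u x r e :
  (K #= `I_s)%card -> K u -> 0 < r -> 0 <= e -> u <= x ->
  (forall y, u <= y <= x -> y < sup K + e /\ exists2 v, K v & v - r < y < v + r) ->
  x - u < 2 * r * (s%:R - 1) + e.
Proof.
move=> Ks Ku r0 e0 ux cover.
rewrite ltNge; apply/negP => far.
have [xsup _] : x < sup K + e /\ exists2 v, K v & v - r < x < v + r.
  by apply: cover; rewrite ux lexx.
have [M KM Mfar] : exists2 M, K M & u + 2 * r * (s%:R - 1) < M.
  by apply: sup_gt; [exists u|lra].
(* The bucket 0 holds u, and the bucket s is unbounded on the right. *)
pose bucket k v := [/\ K v, u + 2 * r * (k%:R - 1) < v &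
   (k < s)%N -> v <= u + 2 * r * k%:R].
have bucketP k : exists v, (k <= s)%N -> bucket k v.
  have [->|k0] := posnP k.
    by exists u => _; split=> // [|_]; lra.
  have [ks|sk] := ltnP k s; last first.
    exists M => ks; have -> : k = s by apply/eqP; rewrite eqn_leq ks sk.
    by split=> //; rewrite ltnn.
  have k1 : 1 <= k%:R :> R by rewrite ler1n.
  have ks1 : k%:R + 1 <= s%:R :> R by rewrite natr1 ler_nat.
  have y_in : u <= u + 2 * r * k%:R - r <= x.
    have : 0 <= r * (k%:R - 1) by rewrite mulr_ge0 ?(ltW r0) // subr_ge0.
    have : 0 <= r * (s%:R - (k%:R + 1)) by rewrite mulr_ge0 ?(ltW r0) // subr_ge0.
    by move=> ? ?; apply/andP; split; lra.
  have [_ [v Kv /andP[vy yv]]] := cover _ y_in.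
  by exists v => _; split=> // [|_]; lra.
have [f fP] := choice bucketP.
have finj : {in `I_s.+1 &, injective f}.
  have lem i j : (i < j)%N -> (j <= s)%N -> f i < f j.
    move=> ij js; have [_ lo _] := fP j js.
    have [_ _ /(_ (leq_trans ij js)) hi] := fP i (ltnW (leq_trans ij js)).
    have : 0 <= r * (j%:R - (i%:R + 1)) by rewrite mulr_ge0 ?(ltW r0) // subr_ge0 natr1 ler_nat.
    by move: lo hi; lra.
  move=> i j; rewrite !inE /= !ltnS => i_s j_s E.
  case: (ltngtP i j) => // h; exfalso.
    by have := lem i j h j_s; rewrite E ltxx.
  by have := lem j i h i_s; rewrite E ltxx.
have : (f @` `I_s.+1 #<= `I_s)%card.
  rewrite -(card_le_eqr Ks); apply: subset_card_le => _ [k /= ks <-].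
  by have [] := fP k ks.
by rewrite (card_le_eql (inj_card_eq finj)) card_le_II ltnn.
Qed.

Lemma open_bounded_right_end (U : set R) x M : open U -> U x -> (forall y, U y -> y < M) ->
  exists d, [/\ x < d, ~ U d & forall y, x <= y < d -> U y].
Proof.
move=> oU Ux UM.
pose E : set R := [set y | x <= y /\ ~ U y].
have EM : E M.
  split; first exact/ltW/UM.
  by move=> /UM; rewrite ltxx.
have lE : has_lbound E by exists x => y [].
have infE y : E y -> inf E <= y by move=> Ey; exact: ge_inf.
have xE : x <= inf E by apply: lb_le_inf; [exists M|move=> y []].
have Uin y : x <= y < inf E -> U y.
  move=> /andP[xy yE]; apply: contrapT => nUy.
  by have := infE y (conj xy nUy); rewrite leNgt yE.
have nU : ~ U (inf E).
  move=> UE; have [e /= e0 ball_e] := (nbhs_ballP _ _).1 (open_nbhs_nbhs (conj oU UE)).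
  have : inf E + e <= inf E; last by rewrite gerDl leNgt e0.
  apply: lb_le_inf; first by exists M.
  move=> y Ey; rewrite leNgt; apply/negP => ye; case: (Ey) => xy; apply; apply: ball_e.
  by rewrite -ball_normE /= ltr_norml; have := infE y Ey; move=> ?; apply/andP; split; lra.
exists (inf E); split=> //; rewrite lt_neqAle xE andbT.
by apply: contraPneq nU => <-.
Qed.

Lemma open_bounded_left_end (U : set R) x m : open U -> U x -> (forall y, U y -> m < y) ->
  exists c, [/\ c < x, ~ U c & forall y, c < y <= x -> U y].
Proof.
move=> oU Ux Um.
have oV : open [set y | U (- y)].
  by apply: (open_comp _ oU) => y _; exact: opp_continuous.
have [||d [xd nUd Hd]] := @open_bounded_right_end _ (- x) (- m) oV.
- by rewrite /= opprK.
- by move=> y /= /Um; rewrite ltrNr.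
exists (- d); split=> //; first by rewrite ltrNl.
by move=> y yin; have := Hd (- y); rewrite /= opprK; apply; lra.
Qed.

End Clusters.

Section FiniteBounds.
Variable R : realType.
Lemma finite_has_ubound (S : set R) : finite_set S -> has_ubound S.
Proof.
move=> /finite_seqP[s ->]; exists (\sum_(x <- s) `|x|) => x /= xs.
rewrite (big_rem x) //=; apply: le_trans (ler_norm x) _.
by rewrite lerDl sumr_ge0.
Qed.

Lemma finite_has_lbound (S : set R) : finite_set S -> has_lbound S.
Proof.
move=> fS; apply/has_lb_ubN/finite_has_ubound; exact: finite_image.
Qed.
End FiniteBounds.

(** * Zeros of exponential sums *)

Section ExponentialSum.
Variables (R : realType) (t : nat) (a : 'I_t -> R) (beta : 'I_t -> R[i]).

Let b j : R := complex.Re (beta j).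
Let g j : R := complex.Im (beta j).

Lemma exp_termE j (x y : R) : exp_term a beta j (Complex x y) =
  Complex (expR (a j * x + b j) * cos (a j * y + g j))
          (expR (a j * x + b j) * sin (a j * y + g j)).
Proof.
rewrite /exp_term /cexp /b /g; case: (beta j) => u v /=.
apply/eqP; rewrite eq_complex /=; apply/andP.
by rewrite !(mul0r, mulr0, subr0, addr0, add0r); split.
Qed.

Lemma norm_exp_termE j (x y : R) :
  `|exp_term a beta j (Complex x y)| = Complex (expR (a j * x + b j)) 0.
Proof.
rewrite exp_termE normc_def /= !exprMn -mulrDr cos2Dsin2 mulr1 sqrtr_sqr.
by rewrite ger0_norm ?expR_ge0.
Qed.

Lemma max_term_atE (x y : R) p :
  max_term_at a beta (Complex x y) p <-> top_line a b x p.
Proof.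
split=> H j; have := H j; rewrite !norm_exp_termE lecR ler_expR //.
Qed.

Lemma tropE : trop a beta = kinks a b.
Proof.
apply/seteqP; split=> [_ [[x y] [p [q [pq Hp Hq]]] <-] /=|u [p [q [pq Hp Hq]]]].
  by exists p, q; split=> //; apply/max_term_atE; [exact: Hp|exact: Hq].
by exists (Complex u 0) => //; exists p, q; split=> //; exact/max_term_atE.
Qed.

Lemma exp_sumE (x y : R) : exp_sum a beta (Complex x y) =
  Complex (re_sum a b x (fun j => a j * y + g j))
          (im_sum a b x (fun j => a j * y + g j)).
Proof.
rewrite /exp_sum /re_sum /im_sum.
under eq_bigr => j _ do rewrite exp_termE.
by elim/big_rec3 : _ => // j u v w _ ->.
Qed.

Lemma zerosP (x y : R) : zeros a beta (Complex x y) <->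
  re_sum a b x (fun j => a j * y + g j) = 0 /\
  im_sum a b x (fun j => a j * y + g j) = 0.
Proof. by rewrite /zeros /= exp_sumE; split=> [[-> ->]|[-> ->]]. Qed.

Lemma min_gap_gt0_separated : (1 < t)%N -> injective a ->
  0 < min_gap a /\ separated a (min_gap a).
Proof.
move=> t1 ainj.
pose i0 : 'I_t := Ordinal (ltnW t1); pose i1 : 'I_t := Ordinal t1.
set S := [set x | exists p q : 'I_t, p != q /\ x = `|a p - a q|].
have S0 : S !=set0 by exists `|a i0 - a i1|, i0, i1.
have lS : has_lbound S by exists 0 => _ [p [q [_ ->]]].
split; last by move=> i j ij; apply: (ge_inf lS); exists i, j.
pose P (z : 'I_t * 'I_t) := z.1 != z.2.
have P01 : P (i0, i1) by [].
case: (@Order.TotalTheory.arg_minP _ R ('I_t * 'I_t)%type (i0, i1) P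
  (fun z => `|a z.1 - a z.2|) P01) => -[p q] pq Hmin.
apply: (@lt_le_trans _ _ `|a p - a q|).
  by rewrite normr_gt0 subr_eq0; apply: contra pq => /eqP/ainj ->.
apply: (lb_le_inf S0) => _ [i [j [ij ->]]].
exact: (Hmin (i, j)).
Qed.

Hypothesis t_gt1 : (1 < t)%N.
Hypothesis a_inj : injective a.

Let p0 : 'I_t := Ordinal (ltnW t_gt1).
Let d := min_gap a.
Let K := kinks a b.
Let U := root_region a beta.

Let d_gt0 : 0 < d. Proof. by case: (min_gap_gt0_separated t_gt1 a_inj). Qed.
Let sep : separated a d. Proof. by case: (min_gap_gt0_separated t_gt1 a_inj). Qed.

Lemma finite_kinks : finite_set K.
Proof. exact: card_le_finite (kinks_card_le b a_inj) (finite_II _). Qed.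

Lemma ln_gap_gt0 (m : R) : 1 < m -> 0 < ln m / d.
Proof. by move=> m1; rewrite divr_gt0 ?ln_gt0. Qed.

Lemma root_regionP y : U y <->
  inf K - ln 2 / d < y < sup K + ln 2 / d /\
  exists2 u, K u & u - ln 3 / d < y < u + ln 3 / d.
Proof.
rewrite /U /root_region /trop_min /trop_max tropE; split.
  by move=> [/=]; rewrite in_itv /= => h [u Ku]; rewrite /= in_itv /= => h'; split=> //; exists u.
move=> [h [u Ku h']]; split; first by rewrite /= in_itv.
by exists u => //=; rewrite in_itv.
Qed.

Lemma open_root_region : open U.
Proof.
apply: openI; first exact: interval_open.
by apply: bigcup_open => u _; exact: interval_open.
Qed.

Lemma has_ubound_kinks : has_ubound K.
Proof. exact: finite_has_ubound finite_kinks. Qed.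

Lemma has_lbound_kinks : has_lbound K.
Proof. exact: finite_has_lbound finite_kinks. Qed.

(** The three ways of leaving the region correspond to the three dominance
    lemmas. *)
Lemma dominates_off_root_region y : ~ U y -> exists p, dominates a b y p.
Proof.
move=> nUy.
have [yl|yl] := leP y (inf K - ln 2 / d).
  apply: (dominates_left_of_kinks p0 d_gt0 sep) => u Ku.
  by have := ge_inf has_lbound_kinks Ku; lra.
have [yr|yr] := leP (sup K + ln 2 / d) y.
  apply: (dominates_right_of_kinks p0 d_gt0 sep) => u Ku.
  by have := ub_le_sup has_ubound_kinks Ku; lra.
apply: (dominates_far_from_kinks p0 d_gt0 sep) => u Ku.
rewrite leNgt; apply/negP; rewrite ltr_norml => /andP[? ?]; apply: nUy.
apply/root_regionP; split; first by rewrite yl.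
by exists u => //; apply/andP; split; lra.
Qed.

Lemma zero_in_root_region z : zeros a beta z -> U (complex.Re z).
Proof.
case: z => x y /zerosP[re0 im0] /=; apply: contrapT => /dominates_off_root_region[p dom].
have := dominates_dot_gt0 (fun j => a j * y + g j) dom.
by rewrite re0 im0 !mulr0 addr0 ltxx.
Qed.

Lemma kink_in_root_region u : K u -> U u.
Proof.
move=> Ku; have l2 : 0 < ln 2 / d by apply: ln_gap_gt0; lra.
have l3 : 0 < ln 3 / d by apply: ln_gap_gt0; lra.
have := ge_inf has_lbound_kinks Ku; have := ub_le_sup has_ubound_kinks Ku.
move=> ? ?; apply/root_regionP; split; first by apply/andP; split; lra.
by exists u => //; apply/andP; split; lra.
Qed.

(** The maximal interval [(c, e)] of the region around [x] has both ends outside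
    the region, so one term dominates at each end; the two terms differ because
    the interval contains a kink, and there is a root between them. *)
Lemma zero_in_component x : U x -> exists c e z,
  [/\ c < x < e, forall y, c < y < e -> U y, zeros a beta z & c < complex.Re z < e].
Proof.
move=> Ux.
have [e [xe nUe Ue]] : exists e, [/\ x < e, ~ U e & forall y, x <= y < e -> U y].
  apply: (open_bounded_right_end open_root_region Ux (M := sup K + ln 2 / d)).
  by move=> y /root_regionP[/andP[]].
have [c [cx nUc Uc]] : exists c, [/\ c < x, ~ U c & forall y, c < y <= x -> U y].
  apply: (open_bounded_left_end open_root_region Ux (m := inf K - ln 2 / d)).
  by move=> y /root_regionP[/andP[]].
have Uce y : c < y < e -> U y.
  move=> /andP[cy ye]; have [yx|xy] := leP y x; first by apply: Uc; rewrite cy.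
  by apply: Ue; rewrite ye ltW.
have [p domp] := dominates_off_root_region nUc.
have [q domq] := dominates_off_root_region nUe.
have [u Ku ceu] : exists2 u, K u & c <= u <= e.
  have /root_regionP[/andP[xl xr] [u Ku /andP[ux xu]]] := Ux.
  have /root_regionP[/andP[ul ur] _] := kink_in_root_region Ku.
  have l3 : 0 < ln 3 / d by apply: ln_gap_gt0; lra.
  exists u => //; rewrite !leNgt; apply/andP; split; apply/negP => h.
    apply: nUc; apply/root_regionP; split; first by apply/andP; split; lra.
    by exists u => //; apply/andP; split; lra.
  apply: nUe; apply/root_regionP; split; first by apply/andP; split; lra.
  by exists u => //; apply/andP; split; lra.
have pq : p != q.
  by apply/eqP => E; rewrite -E in domq; exact: (dominates_no_kink domp domq ceu).
have [v [w [vin re0 im0]]] :=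
  root_between_dominants g (ltW (lt_trans cx xe)) a_inj pq domp domq.
exists c, e, (Complex v w); split=> //; first by rewrite cx.
exact/zerosP.
Qed.

Lemma component_meets_zeros x : U x ->
  (connected_component U x `&` (@complex.Re R @` zeros a beta)) !=set0.
Proof.
move=> /zero_in_component[c [e [z [xin Uce zz zin]]]].
exists (complex.Re z); split; last by exists z.
have sub : `]c, e[%classic `<=` U by move=> y /=; rewrite in_itv /=; exact: Uce.
have x_ce : `]c, e[%classic x by rewrite /= in_itv.
have conn : connected `]c, e[%classic by exact/connected_intervalP/interval_is_interval.
by apply: (connected_component_max x_ce sub conn); rewrite /= in_itv.
Qed.

(** The root lies in the same interval of the region as [u], and such an interval
    cannot extend far from [u] by [ball_chain_lt_sup]; for a root on the left
    of [u], that lemma is applied to the opposite set of kinks. *)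
Lemma zero_near_kink (s : nat) u : (K #= `I_s)%card -> K u ->
  exists2 z, zeros a beta z &
    `|u - complex.Re z| < (2 * ln 3 * (s%:R - 1) + ln 2) / d.
Proof.
move=> Ks Ku.
have [c [e [z [/andP[cu ue] Uce zz /andP[cz ze]]]]] :=
  zero_in_component (kink_in_root_region Ku).
exists z => //; move: (complex.Re z) cz ze => x cx xe.
have l2 : 0 <= ln 2 / d by apply/ltW/ln_gap_gt0; lra.
have l3 : 0 < ln 3 / d by apply: ln_gap_gt0; lra.
have -> : (2 * ln 3 * (s%:R - 1) + ln 2) / d = 2 * (ln 3 / d) * (s%:R - 1) + ln 2 / d.
  by ring.
have [ux|xu] := leP u x.
  rewrite distrC ger0_norm ?subr_ge0 //.
  apply: (ball_chain_lt_sup Ks Ku l3 l2 ux) => y yin.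
  have /root_regionP[/andP[_ yr] cov] : U y by apply: Uce; lra.
  by split.
rewrite gtr0_norm ?subr_gt0 //.
have KsN : ((-%R @` K) #= `I_s)%card.
  by apply: card_eq_trans Ks; apply: inj_card_eq => v w _ _; exact: oppr_inj.
have -> : u - x = - x - (- u) by ring.
have KuN : (-%R @` K) (- u) by exists u.
apply: (ball_chain_lt_sup KsN KuN l3 l2); first by rewrite lerN2 ltW.
move=> y yin.
have /root_regionP[/andP[yl _] [v Kv vin]] : U (- y) by apply: Uce; lra.
split; first by move: yl; rewrite /inf; lra.
by exists (- v); [exists v|lra].
Qed.

End ExponentialSum.

Theorem theorem1p5 (R : realType) (t : nat) (a : 'I_t -> R)
    (beta : 'I_t -> R[i]) (t_ge3 : (3 <= t)%N) (a_inj : injective a) :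
  exists s : nat,
    [/\ (trop a beta #= `I_s)%card,
        (1 <= s <= t - 1)%N,
        @complex.Re R @` zeros a beta `<=` root_region a beta,
        forall x : R, root_region a beta x ->
          (connected_component (root_region a beta) x `&`
             (@complex.Re R @` zeros a beta)) !=set0
      & forall u : R, trop a beta u ->
          exists zeta : R[i],
            [/\ zeros a beta zeta,
                `|u - complex.Re zeta| < (ln 9 * s%:R - ln (9 / 2)) / min_gap a,
                (ln 9 * s%:R - ln (9 / 2)) / min_gap a
                  <= (ln 9 * t%:R - ln (81 / 2)) / min_gap a
              & (ln 9 * t%:R - ln (81 / 2)) / min_gap a
                  < (22 / 10 * t%:R - 37 / 10) / min_gap a]].
Proof.
have t1 : (1 < t)%N by apply: leq_trans t_ge3.
have [gap_gt0 _] := min_gap_gt0_separated t1 a_inj.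
have [s Ks] := (finite_setP _).1 (finite_kinks beta a_inj).
have st : (s <= t - 1)%N.
  by rewrite -card_le_II -(card_le_eql Ks); exact: kinks_card_le.
have [dist le_t lt_t] := root_distance_bounds gap_gt0 t_ge3 st.
exists s; rewrite tropE; split.
- exact: Ks.
- rewrite st andbT lt0n; apply/eqP => s0.
  have := kinks_neq0 (fun j => complex.Re (beta j)) t1 a_inj.
  move: Ks; rewrite s0 II0 card_eq0 => /eqP ->.
  by case.
- by move=> _ [z zz <-]; exact: zero_in_root_region.
- exact: component_meets_zeros.
- move=> u Ku; have [z zz hz] := zero_near_kink t1 a_inj Ks Ku.
  by exists z; split=> //; rewrite dist.
Qed.
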